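(* Let $m \geq 2$ and let $s$ be a positive integer not divisible by $m$. Let $A = \{um + s : u \geq 0\}$, $B = \{vm + 2s : v \geq 1\}$, and $H = A \cup B$; each $h \in H$ is written uniquely as $h = v(h)m + t(h)$ with $v(h) \geq 0$ an integer and $t(h) \in \{s, 2s\}$. For a positive integer $n$, let $q_A(n)$ be the number of partitions of $n$ into distinct elements of $A$, and let $q_H(n)$ be the number of partitions of $n$ of the form $n = h_1 + \cdots + h_d$ with $h_i \in H$ for $i = 1,\ldots,d$, $v(h_i) - v(h_{i+1}) \geq 3$ for $i = 1,\ldots,d-1$, and $v(h_i) - v(h_{i+1}) \geq 4$ whenever $h_{i+1} \in B$. Then $q_A(n) = q_H(n)$. *)

(* Defs.v *)
From mathcomp Require Import all_boot.
From mathcomp Require Import zify.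

Set Implicit Arguments.
Unset Strict Implicit.
Unset Printing Implicit Defensive.

(* The bounds on [u] and [v] only serve decidability, see [inAP] and [inBP]. *)
Definition inA (m s : nat) : pred nat :=
  fun h => [exists u : 'I_h.+1, h == u * m + s].

Definition inB (m s : nat) : pred nat :=
  fun h => [exists v : 'I_h.+1, (1 <= v) && (h == v * m + 2 * s)].

Definition inH (m s : nat) : pred nat := fun h => inA m s h || inB m s h.

(* The decomposition h = v(h) m + t(h), meaningful for h in H;
   see [tvH_spec] and [tvH_uniq]. *)
Definition tH (m s h : nat) : nat := if inA m s h then s else 2 * s.

Definition vH (m s h : nat) : nat := (h - tH m s h) %/ m.

Definition is_partition (n : nat) (p : seq nat) : bool :=
  [&& sorted geq p, all (fun x => 0 < x) p & sumn p == n].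

(* A partition of n has at most n parts, each at most n, so that the finite
   type [n.-bseq 'I_n.+1] contains all of them; see [partition_bseq]. *)
Definition parts (n : nat) (p : n.-bseq 'I_n.+1) : seq nat :=
  [seq val i | i <- p].

Definition num_partitions (n : nat) (P : pred (seq nat)) : nat :=
  #|[set p : n.-bseq 'I_n.+1 | is_partition n (parts p) && P (parts p)]|.

Definition qA (m s n : nat) : nat :=
  num_partitions n (fun p => uniq p && all (inA m s) p).

Definition gapH (m s : nat) : rel nat := fun h h' =>
  (vH m s h' + 3 <= vH m s h) && (inB m s h' ==> (vH m s h' + 4 <= vH m s h)).

Definition admissibleH (m s : nat) (h : seq nat) : bool :=
  all (inH m s) h && sorted (gapH m s) h.

(* The summands h_1, ..., h_d are ordered by decreasing v, which need not be
   their numerical order: for m = 2 and s = 9 the admissible sequence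
   (5 m + s, m + 2 s) = (19, 20) increases. Hence "n = h_1 + ... + h_d" is
   some rearrangement of the parts, rather than their decreasing listing. *)
Definition qH (m s n : nat) : nat :=
  num_partitions n (fun p => has (admissibleH m s) (permutations p)).

Lemma inAP (m s h : nat) : 2 <= m -> reflect (exists u, h = u * m + s) (inA m s h).
Proof.
move=> m2; apply: (iffP existsP) => [[u /eqP ->]|[u eh]]; first by exists u.
have lu : u < h.+1 by nia.
by exists (Ordinal lu); apply/eqP.
Qed.

Lemma inBP (m s h : nat) : 2 <= m ->
  reflect (exists2 v, 1 <= v & h = v * m + 2 * s) (inB m s h).
Proof.
move=> m2; apply: (iffP existsP) => [[v /andP[v1 /eqP ->]]|[v v1 eh]].
  by exists v.
have lv : v < h.+1 by nia.
by exists (Ordinal lv); rewrite v1 /=; apply/eqP.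
Qed.

Lemma tvH_spec (m s h : nat) : 2 <= m -> inH m s h ->
  h = vH m s h * m + tH m s h /\ (tH m s h = s \/ tH m s h = 2 * s).
Proof.
move=> m2 hH; split; last by rewrite /tH; case: ifP; [left|right].
rewrite /vH /tH; case: (inAP s h m2) => [[u ->]|nA].
  by rewrite addnK mulnK //; lia.
move: hH; rewrite /inH => /orP[/(inAP _ _ m2)//|/(inBP _ _ m2)[v v1 ->]].
by rewrite addnK mulnK //; lia.
Qed.

Lemma tvH_uniq (m s v v' t t' : nat) : 2 <= m -> ~~ (m %| s) ->
  t \in [:: s; 2 * s] -> t' \in [:: s; 2 * s] ->
  v * m + t = v' * m + t' -> v = v' /\ t = t'.
Proof.
move=> m2 nms; rewrite !inE => /orP[]/eqP-> /orP[]/eqP-> e.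
- by split=> //; nia.
- by case/negP: nms; apply/dvdnP; exists (v - v'); nia.
- by case/negP: nms; apply/dvdnP; exists (v' - v); nia.
- by split=> //; nia.
Qed.

Lemma partition_bseq (n : nat) (p : seq nat) : is_partition n p ->
  exists! b : n.-bseq 'I_n.+1, parts b = p.
Proof.
case/and3P=> _ p1 /eqP sp.
have sz : size p <= n.
  by rewrite -sp; elim: p p1 {sp} => //= x p IH /andP[x1 /IH]; lia.
have le x : x \in p -> x <= n.
  rewrite -sp; elim: p {p1 sp sz} => //= y p IH.
  by rewrite inE => /orP[/eqP->|/IH]; lia.
have szi : size [seq (inord i : 'I_n.+1) | i <- p] <= n by rewrite size_map.
have E : parts (Bseq szi) = p.
  rewrite /parts /= -map_comp -[RHS]map_id; apply/eq_in_map => x /le xn /=.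
  by rewrite inordK.
exists (Bseq szi); split=> // b' eb'; apply: val_inj.
by apply: (inj_map val_inj); rewrite -[RHS]/(parts b') eb'.
Qed.

Lemma has_admissibleP (m s : nat) (p : seq nat) :
  reflect (exists2 h, perm_eq h p & admissibleH m s h)
    (has (admissibleH m s) (permutations p)).
Proof.
by apply: (iffP hasP) => -[h hp Hh]; exists h; rewrite // ?mem_permutations // -mem_permutations.
Qed.

(* Main.v *)
Require Import Defs.
From mathcomp Require Import all_boot.
From mathcomp Require Import all_algebra.
From mathcomp Require Import zify ring.

Set Implicit Arguments.
Unset Strict Implicit.
Unset Printing Implicit Defensive.

(* Let R_i(x) be the generating function, in x = X^s and q = X^m, of the
   admissible sequences with v < i on parts of A and v + 1 < i on parts of B.
   Removing the part with the largest v gives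
     R_{i+1}(x) = R_i(x) + x q^i R_{i-2}(x) + x^2 q^{i-1} R_{i-3}(x),
   and this recurrence alone yields, by induction on i,
     R_{i+2}(x) = R_{i+1}(xq) + x R_i(xq).
   As i grows this becomes R(x) = (1 + x) R(xq), the functional equation of
   the product of the 1 + x q^u, u >= 0, which counts the partitions into
   distinct elements of A. Since xq = X^(s + m), the substitution x -> xq is
   just a change of s. *)

(* The sequences counted by R_i. For i = j + 1 the part of B with v = j - 1 is
   available only if j > 1, as B requires v >= 1; the truncation of [j - 2] and
   [j - 3] is harmless, since [gap_seqs m s 0] contains only [[::]]. *)
Fixpoint gap_seqs (m s i : nat) : seq (seq nat) :=
  if i is j.+1 then
    gap_seqs m s j
    ++ [seq j * m + s :: p | p <- gap_seqs m s (j - 2)]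
    ++ (if 1 < j then [seq j.-1 * m + 2 * s :: p | p <- gap_seqs m s (j - 3)]
        else [::])
  else [:: [::]].

Fixpoint distinct_seqs (m s L : nat) : seq (seq nat) :=
  if L is l.+1 then
    distinct_seqs m s l ++ [seq l * m + s :: p | p <- distinct_seqs m s l]
  else [:: [::]].

(** * Generating functions, their recurrences and a coefficient comparison *)

Section GeneratingFunctions.

Import GRing.Theory.
Local Open Scope ring_scope.

Definition sum_gf (l : seq (seq nat)) : {poly int} := \sum_(p <- l) 'X^(sumn p).

Lemma sum_gf_cat l1 l2 : sum_gf (l1 ++ l2) = sum_gf l1 + sum_gf l2.
Proof. exact: big_cat. Qed.

Lemma sum_gf_cons h l : sum_gf [seq h :: p | p <- l] = 'X^h * sum_gf l.
Proof.
by rewrite /sum_gf big_map mulr_sumr; apply: eq_bigr => p _; rewrite -exprD.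
Qed.

Lemma coef_sum_gf l n : (sum_gf l)`_n = (count (fun p => sumn p == n) l)%:R.
Proof.
rewrite /sum_gf coef_sum -sum1_count natr_sum [RHS]big_mkcond.
by apply: eq_bigr => p _; rewrite coefXn eq_sym; case: eqP.
Qed.

Lemma distinct_gf m s L :
  sum_gf (distinct_seqs m s L) = \prod_(u < L) (1 + 'X^(u * m + s)).
Proof.
elim: L => [|L IH] /=; first by rewrite big_ord0 /sum_gf big_seq1.
by rewrite big_ord_recr /= sum_gf_cat sum_gf_cons IH; ring.
Qed.

Lemma distinct_gfS m s L :
  sum_gf (distinct_seqs m s L.+1)
    = (1 + 'X^s) * sum_gf (distinct_seqs m (s + m) L).
Proof.
rewrite !distinct_gf big_ord_recl mul0n add0n; congr (_ * _).
by apply: eq_bigr => u _; rewrite lift0; congr (1 + 'X^_); lia.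
Qed.

Lemma gap_gf0 m s : sum_gf (gap_seqs m s 0) = 1.
Proof. by rewrite /sum_gf big_seq1. Qed.

Lemma gap_gfS m s i :
  sum_gf (gap_seqs m s i.+1) = sum_gf (gap_seqs m s i)
    + 'X^(i * m + s) * sum_gf (gap_seqs m s (i - 2))
    + (if (1 < i)%N then
         'X^(i.-1 * m + 2 * s) * sum_gf (gap_seqs m s (i - 3)) else 0).
Proof.
rewrite [gap_seqs m s i.+1]/= !sum_gf_cat sum_gf_cons addrA.
by case: ifP; rewrite ?sum_gf_cons // /sum_gf big_nil.
Qed.

Lemma gap_gf4 m s i :
  sum_gf (gap_seqs m s i.+4) = sum_gf (gap_seqs m s i.+3)
    + 'X^(i.+3 * m + s) * sum_gf (gap_seqs m s i.+1)
    + 'X^(i.+2 * m + 2 * s) * sum_gf (gap_seqs m s i).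
Proof. by rewrite gap_gfS !subSS !subn0. Qed.

Lemma gap_gf_shift m s i :
  sum_gf (gap_seqs m s i.+2) = sum_gf (gap_seqs m (s + m) i.+1)
                             + 'X^s * sum_gf (gap_seqs m (s + m) i).
Proof.
(* Rewriting in [q = 'X^m] and [x = 'X^s] leaves identities that [ring] can decide. *)
have XA j t : 'X^(j * m + t) = 'X^m ^+ j * 'X^t :> {poly int}.
  by rewrite exprD mulnC exprM.
have XB t : 'X^(2 * t) = 'X^t ^+ 2 :> {poly int} by rewrite mulnC exprM.
have [k] := ubnP i; elim: k i => // k IH [|[|[|[|i]]]] lik.
(* [gap_gf4] applies to the last term on the right only for indices from 4 on; smaller ones are
   computed. *)
1-4: by rewrite !gap_gfS !gap_gf0 /= !(XA, XB) exprD; ring.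
(* Only series for [s + m] remain. Those of index [i.+1] match crosswise: the A-term on the left
   yields the B-term on the right, and conversely. *)
rewrite [LHS]gap_gf4 [in RHS](gap_gf4 _ _ i.+1) !IH; [|lia..].
rewrite !(gap_gf4 _ _ i).
by rewrite !(XA, XB) !exprS exprD; ring.
Qed.

(** All parts are at least [s], so below degree [s] only the empty sequence contributes. *)
Lemma coef_gap_gf_small m s i n : (n < s)%N ->
  (sum_gf (gap_seqs m s i))`_n = (n == 0)%:R.
Proof.
move=> ns; elim: i => [|i IH]; first by rewrite gap_gf0 coef1.
have X0 t p : (n < t)%N -> ('X^t * p : {poly int})`_n = 0.
  by rewrite coefXnM => ->.
rewrite gap_gfS !coefD IH X0 ?ltn_addl // addr0.
case: ifP => _; last by rewrite coef0 addr0.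
by rewrite X0 ?addr0 // ltn_addl // mulSn ltn_addr.
Qed.

(** Each use of the functional equation lowers [L] by 1 and [i] by at most 2, and raises [s] by
    [m >= 1], so both bounds persist; at [L = 0] they give [n < s]. *)
Lemma coef_gap_gf m s L i n : (0 < m)%N -> (n < L + s)%N -> (L.*2 <= i)%N ->
  (sum_gf (gap_seqs m s i))`_n = (sum_gf (distinct_seqs m s L))`_n.
Proof.
move=> m0; elim: L s i n => [|L IH] s i n nLs Li.
  by rewrite coef_gap_gf_small // /sum_gf big_seq1 coef1.
case: i Li => [|[|i]] // Li.
rewrite gap_gf_shift distinct_gfS mulrDl mul1r !coefD !coefXnM.
by rewrite IH; [case: ifP => // _; rewrite IH //|..]; lia.
Qed.

Lemma count_gap_seqs m s L i n : (0 < m)%N -> (n < L + s)%N -> (L.*2 <= i)%N ->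
  count (fun p => sumn p == n) (gap_seqs m s i)
    = count (fun p => sumn p == n) (distinct_seqs m s L).
Proof.
move=> m0 nLs Li; apply/eqP; rewrite -(@Num.Theory.eqr_nat int) -!coef_sum_gf.
exact/eqP/coef_gap_gf.
Qed.

End GeneratingFunctions.

(** * Lists of sequences, and partition numbers as list sizes *)

Lemma mem_map_cons (T : eqType) (x h : T) t (l : seq (seq T)) :
  (h :: t \in [seq x :: p | p <- l]) = (h == x) && (t \in l).
Proof.
apply/mapP/andP => [[p pl [-> ->]]|[/eqP-> tl]]; first by rewrite eqxx.
by exists t.
Qed.

Lemma nil_in_gap_seqs m s i : [::] \in gap_seqs m s i.
Proof. by elim: i => //= i IH; rewrite mem_cat IH. Qed.

Lemma nil_in_distinct_seqs m s L : [::] \in distinct_seqs m s L.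
Proof. by elim: L => //= L IH; rewrite mem_cat IH. Qed.

Lemma uniq_map_cons (T : eqType) (x : T) (l : seq (seq T)) :
  uniq [seq x :: p | p <- l] = uniq l.
Proof. by apply: map_inj_uniq => p q []. Qed.

Lemma num_partitionsE n (P : pred (seq nat)) (l : seq (seq nat)) : uniq l ->
  (forall p, (p \in l) = is_partition n p && P p) ->
  num_partitions n P = size l.
Proof.
move=> ul lP; rewrite /num_partitions cardE -(size_map (@parts n)).
apply/perm_size/uniq_perm => //.
  rewrite map_inj_uniq ?enum_uniq // => b c ebc.
  by apply: val_inj; apply: (inj_map val_inj).
move=> p; apply/mapP/idP => [[b]|pl].
  by rewrite mem_enum inE -lP => bl ->.
have := pl; rewrite lP => /andP[/partition_bseq[b [bp _]] _].
by exists b; rewrite // mem_enum inE bp -lP.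
Qed.

(** * The decomposition in H, and membership in the two recursive lists *)

Section Enumerations.

Variables (m s : nat).
Hypotheses (m2 : 2 <= m) (ms : ~~ (m %| s)).

Lemma s_gt0 : 0 < s.
Proof. by rewrite lt0n; apply: contraNneq ms => ->. Qed.

Lemma inA_mul v : inA m s (v * m + s).
Proof. by apply/inAP => //; exists v. Qed.

(** By uniqueness of the decomposition, a common element of A and B would force [s = 2 * s]. *)
Lemma inH_inA h : inH m s h -> inA m s h = ~~ inB m s h.
Proof.
rewrite /inH; case: (inAP s h m2) => [[u ->] _|_ /= -> //].
case: (inBP s _ m2) => // -[v _ e].
have := @tvH_uniq m s u v s (2 * s) m2 ms; rewrite !inE !eqxx orbT.
by case/(_ isT isT e); have := s_gt0; lia.
Qed.

Lemma inH_eq h : inH m s h ->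
  h = vH m s h * m + (if inB m s h then 2 * s else s).
Proof.
move=> hH; have [+ _] := tvH_spec m2 hH; rewrite /tH inH_inA //.
by case: (inB m s h).
Qed.

Lemma inH_eqA h j : inH m s h ->
  (h == j * m + s) = ~~ inB m s h && (vH m s h == j).
Proof.
move=> hH; have s0 := s_gt0; apply/eqP/andP => [e|[/negbTE nB /eqP<-]].
  have nB : ~~ inB m s h by rewrite -inH_inA // e inA_mul.
  split=> //; apply/eqP.
  by have := inH_eq hH; rewrite (negbTE nB); nia.
by have := inH_eq hH; rewrite nB.
Qed.

Lemma inH_eqB h j : inH m s h ->
  0 < j -> (h == j * m + 2 * s) = inB m s h && (vH m s h == j).
Proof.
move=> hH j0; have s0 := s_gt0; apply/eqP/andP => [e|[hB /eqP<-]].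
  have hB : inB m s h by apply/inBP => //; exists j.
  split=> //; apply/eqP.
  by have := inH_eq hH; rewrite hB; nia.
by have := inH_eq hH; rewrite hB.
Qed.

Lemma inH_vH h : inH m s h -> inB m s h <= vH m s h.
Proof.
case hB: (inB m s h) => // hH.
have [v v0 e] := inBP s h m2 hB.
by move: (inH_eqB hH v0); rewrite -e eqxx hB /= => /esym/eqP->.
Qed.

(** Ensures that the index [n.*2] in [qH_count] excludes no admissible sequence of sum [n]. *)
Lemma vH_ltn h : inH m s h -> vH m s h + inB m s h < h.*2.
Proof.
move=> hH; have := s_gt0; have := inH_eq hH; have := inH_vH hH.
have := leq_mul (leqnn (vH m s h)) m2.
by case: (inB m s h) => /=; lia.
Qed.

(** Passing to [j.+1] adds heads in A with v = [j] and tail index [j - 2], or in B with v = [j - 1]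
    and tail index [j - 3]: the tail index is v - 2 either way, hence depends on the head alone. *)
Lemma mem_gap_seqs_cons i h t :
  (h :: t \in gap_seqs m s i)
  = [&& inH m s h, vH m s h + inB m s h < i
      & t \in gap_seqs m s (vH m s h - 2)].
Proof.
elim: i => [|i IH]; first by rewrite ltn0 andbF.
rewrite /= !mem_cat mem_map_cons IH.
rewrite [_ \in (if _ then _ else _)](_ : _ =
    [&& 1 < i, h == i.-1 * m + 2 * s & t \in gap_seqs m s (i - 3)]); last first.
  by case: ifP; rewrite ?mem_map_cons.
case hH: (inH m s h) => /=; last first.
  have /negbTE-> : h != i * m + s.
    by apply: contraFneq hH => ->; rewrite /inH inA_mul.
  case i1: (1 < i) => //=; have /negbTE-> // : h != i.-1 * m + 2 * s.
  apply: contraFneq hH => e; rewrite /inH; apply/orP; right.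
  by apply/inBP => //; exists i.-1 => //; lia.
rewrite inH_eqA //; have := inH_vH hH.
(* Without the B branch nothing is lost: a head in B has v at least 1, which violates the bound. *)
case i1: (1 < i); last first.
  case: (inB m s _) => /= v0; last by case: eqP => [->|]; case: (_ \in _); lia.
  by case: (_ \in _); lia.
rewrite inH_eqB //; last by lia.
case: (inB m s _) => /= v0.
  case: eqP => [->|/=]; last by case: (_ \in _); lia.
  by rewrite (_ : i.-1 - 2 = i - 3); [case: (_ \in _)|]; lia.
by case: eqP => [->|/=]; case: (_ \in _); lia.
Qed.

Lemma mem_gap_seqs i p :
  (p \in gap_seqs m s i)
  = admissibleH m s p
    && (if p is h :: _ then vH m s h + inB m s h < i else true).
Proof.
elim: p i => [|h t IH] i; first by rewrite nil_in_gap_seqs.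
rewrite mem_gap_seqs_cons IH /admissibleH /=.
case: t {IH} => [|h' t] /=; first by rewrite !andbT.
(* The gap condition is exactly the bound on the head of the tail: gap 3, plus 1 if [h'] is in B. *)
rewrite (_ : gapH m s h h' = (vH m s h' + inB m s h' < vH m s h - 2)).
  case: (inH m s h) => //=; case: (_ < i); rewrite ?andbF ?andbT //=.
  by rewrite -andbA (andbC (path _ _ _)).
by rewrite /gapH; case: (inB m s _) => /=; lia.
Qed.

(** The new heads violate the bound of the previous list, and they differ from each other because A
    and B are disjoint. *)
Lemma uniq_gap_seqs i : uniq (gap_seqs m s i).
Proof.
have [k] := ubnP i; elim: k i => // k IH [|i] //= lik.
rewrite !cat_uniq uniq_map_cons !IH /=; [|lia..].
rewrite [uniq (if _ then _ else _)](_ : _ = true); last first.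
  by case: ifP => // _; rewrite uniq_map_cons IH //; lia.
rewrite andbT; apply/andP; split.
  apply/hasPn => p; rewrite mem_cat => /orP[/mapP[q _ ->]|].
    rewrite /= mem_gap_seqs_cons; apply/negP => /and3P[hH + _].
    by have := inH_eqA i hH; rewrite eqxx => /esym/andP[_ /eqP->]; lia.
  case: ifP => // i1 /mapP[q _ ->]; rewrite /= mem_gap_seqs_cons.
  apply/negP => /and3P[hH + _].
  have := @inH_eqB _ i.-1 hH; rewrite eqxx => /(_ ltac:(lia))/esym.
  by case/andP=> -> /eqP->; lia.
apply/hasPn => p; case: ifP => // i1 /mapP[q _ ->]; rewrite /= mem_map_cons.
apply/negP => /andP[/eqP e _].
have hH : inH m s (i * m + s) by rewrite /inH inA_mul.
have := inH_inA hH; rewrite inA_mul => /esym/negP; apply.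
by rewrite -e; apply/inBP => //; exists i.-1 => //; lia.
Qed.

Lemma mem_distinct_seqs L p :
  (p \in distinct_seqs m s L)
  = [&& sorted gtn p, all (inA m s) p & all (fun h => h < L * m + s) p].
Proof.
elim: L p => [|L IH] [|h t] //.
- rewrite inE /=; apply/esym/negP => /and3P[_ /andP[/(inAP _ _ m2)[u ->] _]].
  by case/andP; lia.
- exact: nil_in_distinct_seqs.
rewrite /= mem_cat mem_map_cons !IH /=.
rewrite path_sortedE; last by move=> x y z /=; lia.
apply/idP/idP.
  case/orP.
    case/and3P=> /andP[-> ->] /andP[-> ->] /andP[hl tl] /=.
    by apply/andP; split; [lia|apply: sub_all tl => x; lia].
  case/andP=> /eqP-> /and3P[-> -> tl]; rewrite inA_mul /= !andbT.
  by rewrite tl /=; apply/andP; split; [lia|apply: sub_all tl => x; lia].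
case/and3P=> /andP[ht ->] /andP[hA ->] /andP[hl tl] /=; rewrite andbT.
have [u e] := inAP s h m2 hA.
have [eu|nu] := eqVneq u L.
  by rewrite e eu eqxx /=; apply/orP; right; rewrite -eu -e.
apply/orP; left; rewrite hA ht /=.
have hL : h < L * m + s by nia.
by rewrite hL /=; apply: sub_all ht => x /= xh; apply: ltn_trans hL.
Qed.

Lemma uniq_distinct_seqs L : uniq (distinct_seqs m s L).
Proof.
elim: L => //= L IH; rewrite cat_uniq uniq_map_cons IH andbT /=.
apply/hasPn => p /mapP[q _ ->]; rewrite /= mem_distinct_seqs /=.
by rewrite ltnn /= !andbF.
Qed.

(** * Partition numbers as counts over the recursive lists *)

Lemma leq_sumn (p : seq nat) x : x \in p -> x <= sumn p.
Proof.
by elim: p => //= y p IH; rewrite inE => /orP[/eqP->|/IH]; lia.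
Qed.

Lemma qA_count n :
  qA m s n = count (fun p => sumn p == n) (distinct_seqs m s n).
Proof.
have s0 := s_gt0.
rewrite -size_filter; apply: num_partitionsE.
  exact/filter_uniq/uniq_distinct_seqs.
move=> p; rewrite mem_filter mem_distinct_seqs /is_partition.
case: eqP => [sn|]; last by rewrite !andbF.
rewrite gtn_sorted_uniq_geq.
have -> : all (fun h => h < n * m + s) p.
  by apply/allP => x /leq_sumn; nia.
case pA: (all (inA m s) p); last by rewrite !andbF.
have -> : all (fun x => 0 < x) p.
  by apply: sub_all pA => x /(inAP _ _ m2)[u ->]; lia.
by rewrite /= !andbT andbC.
Qed.

Lemma inH_gt0 h : inH m s h -> 0 < h.
Proof. by move/vH_ltn; lia. Qed.

(** Admissible sequences decrease strictly in v, so the multiset of parts fixes their order. Hence a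
    partition has at most one admissible rearrangement. *)
Lemma admissibleH_inj p q : admissibleH m s p -> admissibleH m s q ->
  perm_eq p q -> p = q.
Proof.
case/andP=> _ sp /andP[_ sq] /perm_mem pq.
pose r := [rel h h' | vH m s h' < vH m s h].
have gr h h' : gapH m s h h' -> r h h' by case/andP => /= ? _; lia.
apply: (@irr_sorted_eq _ r) => //.
- by move=> x y z /=; lia.
- by move=> x /=; lia.
- exact: sub_sorted sp.
- exact: sub_sorted sq.
Qed.

Lemma qH_count n :
  qH m s n = count (fun p => sumn p == n) (gap_seqs m s n.*2).
Proof.
have geq_tot : total geq by move=> x y /=; lia.
(* Numerical sorting turns admissible sequences into the partitions counted by [qH], injectively by
   [admissibleH_inj]. *)
rewrite -size_filter -(size_map (sort geq)); apply: num_partitionsE.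
  rewrite map_inj_in_uniq; first exact/filter_uniq/uniq_gap_seqs.
  move=> p q; rewrite !mem_filter !mem_gap_seqs.
  move=> /and3P[_ pa _] /and3P[_ qa _] e; apply: admissibleH_inj => //.
  by rewrite -(perm_sort geq) e perm_sort.
move=> p; apply/mapP/andP => [[h + ->]|[/and3P[sp _ /eqP pn]]].
  rewrite mem_filter mem_gap_seqs => /and3P[hn ha _]; split.
    rewrite /is_partition sort_sorted //= all_sort.
    rewrite (perm_sumn (permEl (perm_sort _ _))) hn andbT.
    by case/andP: ha => /sub_all-> // x /inH_gt0.
  by apply/has_admissibleP; exists h; rewrite // perm_sym perm_sort.
case/has_admissibleP => h hp ha; exists h; last first.
  apply: (sorted_eq (leT := geq)); rewrite ?sort_sorted //.
  - by move=> x y z /=; lia.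
  - by move=> x y /=; lia.
  by rewrite perm_sym perm_sort.
have hn : sumn h = n by rewrite (perm_sumn hp).
rewrite mem_filter hn eqxx mem_gap_seqs ha /=.
case: h hn ha {hp} => // x t xn /andP[/= /andP[xH _] _].
by apply: leq_trans (vH_ltn xH) _; rewrite leq_double -xn leq_addr.
Qed.

End Enumerations.

Theorem theorem2 (m s n : nat) (hm : 2 <= m) (hs : 0 < s) (hms : ~~ (m %| s))
  (hn : 0 < n) : qA m s n = qH m s n.
Proof.
(* Here [L = n] and [i = n.*2]; the bound [n < n + s] holds by [hs]. *)
rewrite qA_count // qH_count //; apply/esym/count_gap_seqs; lia.
Qed.
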